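(* Let $q\in\mathbb C$ with $\operatorname{Re} q>0$, let $f$ be a generator on $\mathbb D$ with $f(0)=0$ and $f'(0)=q$, and let $G_r=(\mathrm{Id}+rf)^{-1}$, $r>0$, be its resolvents. Then the net of functions $z\mapsto(1+rq)G_r(z)$ converges to the identity map $z\mapsto z$ as $r\to\infty$, uniformly on compact subsets of $\mathbb D$.
   Context: $\mathbb D=\{z\in\mathbb C:|z|<1\}$. Generators $f$ on $\mathbb D$ with $f(0)=0$, $f'(0)=q$, $\operatorname{Re} q>0$, are exactly the functions $f(z)=zp(z)$ with $p:\mathbb D\to\mathbb C$ holomorphic, $\operatorname{Re} p(z)\ge0$ on $\mathbb D$ and $p(0)=q$. It is known that for every such $f$ and every $r>0$ there is a unique holomorphic map $G_r:\mathbb D\to\mathbb D$ satisfying $G_r(w)+rf(G_r(w))=w$ for all $w\in\mathbb D$; it is univalent with $G_r(0)=0$, is written $G_r=(\mathrm{Id}+rf)^{-1}$, and is called the nonlinear resolvent of $f$ with parameter $r$. *)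

(* Defs.v *)
From Stdlib Require Import Reals List.
From Coquelicot Require Import Coquelicot.
Open Scope C_scope.

(* Functions on the disk are represented by total functions [C -> C]; only
   their values on [unit_disk] are ever constrained or used. *)
Definition unit_disk (z : C) : Prop := (Cmod z < 1)%R.

(* The derivative is the complex one: [C] is the base field [C_AbsRing] here.
   As [unit_disk] is open, it only depends on the values of [f] there. *)
Definition holomorphic_on_disk (f : C -> C) : Prop :=
  forall z : C, unit_disk z ->
    @ex_derive C_AbsRing C_NormedModule f z.

(* Generators [f] on the disk with [f 0 = 0] and [f' 0 = q], in the
   Berkson-Porta form [f z = z * p z]. *)
Definition generator_at_0 (q : C) (f : C -> C) : Prop :=
  exists p : C -> C,
    holomorphic_on_disk p /\
    (forall z : C, unit_disk z -> (0 <= Re (p z))%R) /\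
    p 0 = q /\
    (forall z : C, unit_disk z -> f z = z * p z).

(* On the disk, these conditions determine [G] uniquely. *)
Definition is_resolvent (f : C -> C) (r : R) (G : C -> C) : Prop :=
  holomorphic_on_disk G /\
  (forall w : C, unit_disk w -> unit_disk (G w)) /\
  (forall w : C, unit_disk w -> G w + RtoC r * f (G w) = w).

(* Stdlib's [compact] is restricted to subsets of [R]. *)
Definition compact_C (K : C -> Prop) : Prop :=
  forall (I : Type) (U : I -> C -> Prop),
    (forall i : I, open (U i)) ->
    (forall z : C, K z -> exists i : I, U i z) ->
    exists l : list I, forall z : C, K z -> exists i : I, In i l /\ U i z.

Definition cvg_uniformly_on (K : C -> Prop) (F : R -> C -> C) (g : C -> C) : Prop :=
  forall eps : posreal,
    Rbar_locally p_infty
      (fun r : R => forall z : C, K z -> (Cmod (F r z - g z) < eps)%R).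

(* Main.v *)
(* Writing f z = z p(z) and z = G_r(w), the resolvent equation is
   z (1 + r p(z)) = w. Since Re p >= 0 this gives |z| <= |w| <= rho < 1 on the
   compact set. A Harnack type bound Re p >= c > 0 on |z| <= rho then gives
   |z| <= 1/(c r), so z tends to 0 uniformly, and
   (1 + r q) z - w = - r z (p(z) - q) tends to 0 by continuity of p at 0.
   The Harnack bound comes from the mean value property of p composed with a
   disk map, and the mean value property from Goursat's bisection argument,
   applied to a rectangle in logarithmic polar coordinates. *)
Require Import Defs.
From Stdlib Require Import Reals List Lra.
From Coquelicot Require Import Coquelicot.
Open Scope R_scope.

(** * Bisection argument for additive functions of rectangles *)

Section Bisection.
(* [F x y k] is a quantity attached to the rectangle
   [[x, x + k w] x [y, y + k h]]. *)
Variables (F : R -> R -> R -> R) (a c w h : R).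
Hypothesis w_ge0 : 0 <= w.
Hypothesis h_ge0 : 0 <= h.

Let sub x y k := 0 < k /\ a <= x /\ x + k * w <= a + w /\ c <= y /\ y + k * h <= c + h.

Hypothesis additive : forall x y k, sub x y (2 * k) ->
  F x y (2 * k) = F x y k + F (x + k * w) y k + F x (y + k * h) k
                  + F (x + k * w) (y + k * h) k.

Let big (eps : R) (p : R * R) (k : R) :=
  sub (fst p) (snd p) k /\ eps * k ^ 2 < Rabs (F (fst p) (snd p) k).

(** The last quarter is taken without a test: since eps (2k)^2 = 4 eps k^2, additivity forces one
    quarter of a big rectangle to be big, so it is the fourth one when the other three fail. *)
Let step (eps : R) (k : R) (p : R * R) : R * R :=
  let (x, y) := p in
  if Rlt_dec (eps * k ^ 2) (Rabs (F x y k)) then (x, y) else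
  if Rlt_dec (eps * k ^ 2) (Rabs (F (x + k * w) y k)) then (x + k * w, y) else
  if Rlt_dec (eps * k ^ 2) (Rabs (F x (y + k * h) k)) then (x, y + k * h) else
  (x + k * w, y + k * h).

Let step_big eps k p : big eps p (2 * k) -> big eps (step eps k p) k.
Proof.
destruct p as [x y]; unfold big, step, sub; simpl fst; simpl snd.
intros [S B].
assert (A := additive x y k S).
destruct S as (K & X1 & X2 & Y1 & Y2).
assert (0 <= k * w) by (apply Rmult_le_pos; lra).
assert (0 <= k * h) by (apply Rmult_le_pos; lra).
destruct Rlt_dec as [L1|L1]; [simpl; split; [repeat split|]; lra|].
destruct Rlt_dec as [L2|L2]; [simpl; split; [repeat split|]; lra|].
destruct Rlt_dec as [L3|L3]; [simpl; split; [repeat split|]; lra|].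
simpl fst; simpl snd; split; [repeat split; lra|].
revert B L1 L2 L3; rewrite A.
unfold Rabs; repeat destruct Rcase_abs; simpl; nra.
Qed.

Let step_le eps k p : 0 <= k ->
  fst p <= fst (step eps k p) <= fst p + k * w /\
  snd p <= snd (step eps k p) <= snd p + k * h.
Proof.
intros K; destruct p as [x y]; unfold step.
assert (0 <= k * w) by (apply Rmult_le_pos; lra).
assert (0 <= k * h) by (apply Rmult_le_pos; lra).
repeat destruct Rlt_dec; simpl; lra.
Qed.

Let corner eps := fix corner n := match n with
  | O => (a, c)
  | S n => step eps (/ 2 ^ S n) (corner n)
  end.

Let pow2_pos n : 0 < / 2 ^ n.
Proof. apply Rinv_0_lt_compat, pow_lt; lra. Qed.

Let pow2_S n : / 2 ^ n = 2 * / 2 ^ S n.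
Proof. simpl; field; apply pow_nonzero; lra. Qed.

Let corner_le eps n m :
  fst (corner eps n) <= fst (corner eps (n + m)) /\
  fst (corner eps (n + m)) + / 2 ^ (n + m) * w <= fst (corner eps n) + / 2 ^ n * w /\
  snd (corner eps n) <= snd (corner eps (n + m)) /\
  snd (corner eps (n + m)) + / 2 ^ (n + m) * h <= snd (corner eps n) + / 2 ^ n * h.
Proof.
induction m as [|m IH]; [rewrite Nat.add_0_r; lra|].
rewrite Nat.add_succ_r.
assert (P := pow2_pos (S (n + m))).
assert (E := pow2_S (n + m)).
destruct (step_le eps (/ 2 ^ S (n + m)) (corner eps (n + m))) as [S1 S2]; [lra|].
change (step _ _ _) with (corner eps (S (n + m))) in S1, S2.
rewrite E in IH; lra.
Qed.

(** Nested intervals: every left endpoint lies below every right endpoint, so the supremum of the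
    left endpoints belongs to all the intervals. *)
Let sup_corner (z : nat -> R) (l : R) :
  (forall n m, z n <= z (n + m)%nat /\ z (n + m)%nat + / 2 ^ (n + m) * l <= z n + / 2 ^ n * l) ->
  0 <= l -> exists Z, forall n, z n <= Z <= z n + / 2 ^ n * l.
Proof.
intros H L.
assert (U : forall n m, z m <= z n + / 2 ^ n * l).
{ intros n m; destruct (Nat.le_ge_cases n m) as [J|J];
    destruct (Nat.le_exists_sub _ _ J) as [k [-> _]]; rewrite Nat.add_comm.
  - destruct (H n k) as [_ H2]; assert (P := pow2_pos (n + k)).
    assert (0 <= / 2 ^ (n + k) * l) by (apply Rmult_le_pos; lra); lra.
  - destruct (H m k) as [H1 H2]; assert (P := pow2_pos (m + k)).
    assert (0 <= / 2 ^ (m + k) * l) by (apply Rmult_le_pos; lra); lra. }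
destruct (completeness (fun x => exists n, x = z n)) as [Z [Z1 Z2]].
- exists (z 0%nat + / 2 ^ 0 * l); intros x [n ->]; apply U.
- exists (z 0%nat), 0%nat; reflexivity.
- exists Z; intros n; split; [apply Z1; exists n; reflexivity|].
  apply Z2; intros x [m ->]; apply U.
Qed.

(** Otherwise repeated quartering yields nested rectangles at scales k = 2^-n with |F| > eps k^2.
    They share a point (X, Y), where the smallness hypothesis is violated once 2^-n < delta. *)
Lemma bisection_zero :
  (forall X Y eps, a <= X <= a + w -> c <= Y <= c + h -> 0 < eps ->
    exists delta, 0 < delta /\
      forall x y k, 0 < k < delta ->
        a <= x -> x + k * w <= a + w -> c <= y -> y + k * h <= c + h ->
        x <= X <= x + k * w -> y <= Y <= y + k * h ->
        Rabs (F x y k) <= eps * k ^ 2) ->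
  F a c 1 = 0.
Proof.
intros small.
destruct (Req_dec (F a c 1) 0) as [Z|NZ]; [exact Z|exfalso].
(* Any positive value strictly below |F a c 1| makes the initial rectangle, of scale 1, big. *)
set (eps := Rabs (F a c 1) / 2).
assert (eps_pos : 0 < eps).
{ unfold eps; assert (P := Rabs_pos_lt _ NZ); lra. }
assert (B : forall n, big eps (corner eps n) (/ 2 ^ n)).
{ induction n as [|n IH].
  - unfold big, sub; simpl; rewrite Rinv_1; split; [lra|].
    unfold eps in *; lra.
  - rewrite pow2_S in IH; exact (step_big _ _ _ IH). }
destruct (sup_corner (fun n => fst (corner eps n)) w) as [X HX].
{ intros n m; generalize (corner_le eps n m); tauto. }
{ exact w_ge0. }
destruct (sup_corner (fun n => snd (corner eps n)) h) as [Y HY].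
{ intros n m; generalize (corner_le eps n m); tauto. }
{ exact h_ge0. }
cbv beta in HX, HY.
destruct (small X Y eps) as [delta [D small']].
{ specialize (HX 0%nat); simpl in HX; lra. }
{ specialize (HY 0%nat); simpl in HY; lra. }
{ exact eps_pos. }
destruct (pow_lt_1_zero (/ 2)) with (y := delta) as [n N]; [|exact D|].
{ rewrite Rabs_pos_eq; lra. }
specialize (N n (le_n _)); rewrite pow_inv in N.
assert (P := pow2_pos n).
rewrite Rabs_pos_eq in N by lra.
destruct (B n) as [(_ & S1 & S2 & S3 & S4) Bn].
apply (Rlt_not_le _ _ Bn), small'; auto.
Qed.

End Bisection.

(** * Green's formula on a rectangle *)

Lemma differentiable_pt_lim_continuous (f : R -> R -> R) (x y lx ly : R) :
  differentiable_pt_lim f x y lx ly ->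
  continuous (fun t => f t y) x /\ continuous (f x) y.
Proof.
intros D.
assert (C : continuity_2d_pt f x y).
{ apply differentiable_continuity_pt; exists lx, ly; exact D. }
split; apply continuity_pt_filterlim, continuity_pt_locally; intros eps.
- exact (locally_2d_1d_const_y _ _ _ (C eps)).
- exact (locally_2d_1d_const_x _ _ _ (C eps)).
Qed.

Lemma RInt_dist_const (g : R -> R) (a b m e : R) :
  a <= b -> ex_RInt g a b -> (forall t, a <= t <= b -> Rabs (g t - m) <= e) ->
  Rabs (RInt g a b - (b - a) * m) <= (b - a) * e.
Proof.
intros L I B.
replace (RInt g a b - (b - a) * m) with (RInt (fun t => minus (g t) m) a b).
- apply abs_RInt_le_const; [exact L| |exact B].
  apply @ex_RInt_minus; [exact I|apply ex_RInt_const].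
- apply is_RInt_unique, (is_RInt_minus g (fun _ => m) a b _ (scal (b - a) m)).
  + apply (@RInt_correct R_CompleteNormedModule), I.
  + apply @is_RInt_const.
Qed.

(* Green's formula for the closed form [v dx + u dy], whose coefficients are
   only assumed to be differentiable at each point. *)
Lemma closed_form_rectangle (u v : R -> R -> R) (a b c d : R) :
  a <= b -> c <= d ->
  (forall x y, a <= x <= b -> c <= y <= d ->
    exists ux uy vx, differentiable_pt_lim u x y ux uy /\
                     differentiable_pt_lim v x y vx ux) ->
  RInt (u b) c d - RInt (u a) c d =
  RInt (fun x => v x d) a b - RInt (fun x => v x c) a b.
Proof.
intros ab cd D.
assert (Iv : forall x x' y, a <= x -> x <= x' -> x' <= b -> c <= y <= d ->
  ex_RInt (fun t => v t y) x x').
{ intros x x' y L1 L2 L3 L4; apply @ex_RInt_continuous; intros t.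
  rewrite Rmin_left, Rmax_right by exact L2; intros T.
  destruct (D t y) as (ux & uy & vx & _ & V); [lra|lra|].
  exact (proj1 (differentiable_pt_lim_continuous _ _ _ _ _ V)). }
assert (Iu : forall y y' x, c <= y -> y <= y' -> y' <= d -> a <= x <= b ->
  ex_RInt (u x) y y').
{ intros y y' x L1 L2 L3 L4; apply @ex_RInt_continuous; intros t.
  rewrite Rmin_left, Rmax_right by exact L2; intros T.
  destruct (D x t) as (ux & uy & vx & U & _); [lra|lra|].
  exact (proj2 (differentiable_pt_lim_continuous _ _ _ _ _ U)). }
set (w := b - a); set (h := d - c).
assert (w0 : 0 <= w) by (unfold w; lra).
assert (h0 : 0 <= h) by (unfold h; lra).
(* Counterclockwise circulation of v dx + u dy around the rectangle. Sides shared by two quarters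
   cancel, which gives additivity. *)
set (F := fun x y k =>
  RInt (fun t => v t y) x (x + k * w) - RInt (fun t => v t (y + k * h)) x (x + k * w)
  + RInt (u (x + k * w)) y (y + k * h) - RInt (u x) y (y + k * h)).
enough (Z : F a c 1 = 0).
{ unfold F, w, h in Z.
  replace (a + 1 * (b - a)) with b in Z by ring.
  replace (c + 1 * (d - c)) with d in Z by ring.
  lra. }
assert (ab' : a + w = b) by (unfold w; ring).
assert (cd' : c + h = d) by (unfold h; ring).
apply (bisection_zero F a c w h w0 h0); rewrite ab', cd'.
- intros x y k (K & X1 & X2 & Y1 & Y2).
  assert (kw : 0 <= k * w) by (apply Rmult_le_pos; lra).
  assert (kh : 0 <= k * h) by (apply Rmult_le_pos; lra).
  unfold F.
  replace (x + 2 * k * w) with (x + k * w + k * w) in * by ring.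
  replace (y + 2 * k * h) with (y + k * h + k * h) in * by ring.
  assert (Cv : forall z, c <= z <= d -> RInt (fun t => v t z) x (x + k * w + k * w)
     = RInt (fun t => v t z) x (x + k * w)
       + RInt (fun t => v t z) (x + k * w) (x + k * w + k * w)).
  { intros z Hz; symmetry; apply (@RInt_Chasles R_CompleteNormedModule); apply Iv; lra. }
  assert (Cu : forall z, a <= z <= b -> RInt (u z) y (y + k * h + k * h)
     = RInt (u z) y (y + k * h)
       + RInt (u z) (y + k * h) (y + k * h + k * h)).
  { intros z Hz; symmetry; apply (@RInt_Chasles R_CompleteNormedModule); apply Iu; lra. }
  rewrite !Cv, !Cu by lra; ring.
- intros X Y eps HX HY E.
  destruct (D X Y HX HY) as (ux & uy & vx & DU & DV).
  (* In a rectangle of scale k containing (X, Y), both coordinates stay within k m of X and Y; the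
     summand 1 keeps this strict for degenerate rectangles. Affine approximation with error e k m at
     each point costs at most 2 e k m per unit length in each of the two integrals below, over total
     length k (w + h) <= k m, hence the choice of e of order eps / m^2. *)
  set (m := w + h + 1).
  assert (m_pos : 0 < m) by (unfold m; lra).
  assert (e_pos : 0 < eps / (4 * m ^ 2)).
  { apply Rdiv_lt_0_compat; [exact E|]; assert (0 < m ^ 2) by (apply pow_lt; lra); lra. }
  destruct (DU (mkposreal _ e_pos)) as [d1 H1].
  destruct (DV (mkposreal _ e_pos)) as [d2 H2].
  simpl in H1, H2.
  set (e := eps / (4 * m ^ 2)) in *.
  assert (m0 : 0 < Rmin d1 d2) by (apply Rmin_pos; [apply d1|apply d2]).
  exists (Rmin d1 d2 / m); split; [apply Rdiv_lt_0_compat; assumption|].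
  intros x y k [K Kd] X1 X2 Y1 Y2 XX YY.
  apply Rmult_lt_compat_r with (r := m) in Kd; [|exact m_pos].
  unfold Rdiv in Kd; rewrite Rmult_assoc, Rinv_l, Rmult_1_r in Kd by lra.
  assert (L1 := Rmin_l d1 d2); assert (L2 := Rmin_r d1 d2).
  assert (kw : 0 <= k * w) by (apply Rmult_le_pos; lra).
  assert (kh : 0 <= k * h) by (apply Rmult_le_pos; lra).
  assert (km : k * m = k * w + k * h + k) by (unfold m; ring).
  assert (near : forall s t, x <= s <= x + k * w -> y <= t <= y + k * h ->
    Rabs (u s t - (u X Y + (ux * (s - X) + uy * (t - Y)))) <= e * (k * m) /\
    Rabs (v s t - (v X Y + (vx * (s - X) + ux * (t - Y)))) <= e * (k * m)).
  { intros s t S T.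
    assert (A1 : Rabs (s - X) < k * m) by (apply Rabs_def1; lra).
    assert (A2 : Rabs (t - Y) < k * m) by (apply Rabs_def1; lra).
    assert (A3 : e * Rmax (Rabs (s - X)) (Rabs (t - Y)) <= e * (k * m)).
    { apply Rmult_le_compat_l; [lra|apply Rmax_lub; lra]. }
    split.
    - eapply Rle_trans; [|exact A3].
      rewrite Rminus_plus_distr; apply H1; lra.
    - eapply Rle_trans; [|exact A3].
      rewrite Rminus_plus_distr; apply H2; lra. }
  (* The affine parts contribute -k^2 w h ux here and +k^2 w h ux in [Bu]. They cancel because the
     y-derivative of v is the x-derivative of u. *)
  assert (Bv : Rabs (RInt (fun t => minus (v t y) (v t (y + k * h))) x (x + k * w)
                     - (x + k * w - x) * (- (k * h * ux)))
               <= (x + k * w - x) * (2 * (e * (k * m)))).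
  { apply RInt_dist_const; [lra| |].
    - apply @ex_RInt_minus; apply Iv; lra.
    - intros t T.
      destruct (near t y) as [_ N1]; [lra|lra|].
      destruct (near t (y + k * h)) as [_ N2]; [lra|lra|].
      apply Rabs_le_between in N1; apply Rabs_le_between in N2.
      apply Rabs_le_between; unfold minus, plus, opp; simpl; lra. }
  assert (Bu : Rabs (RInt (fun t => minus (u (x + k * w) t) (u x t)) y (y + k * h)
                     - (y + k * h - y) * (k * w * ux))
               <= (y + k * h - y) * (2 * (e * (k * m)))).
  { apply RInt_dist_const; [lra| |].
    - apply @ex_RInt_minus; apply Iu; lra.
    - intros t T.
      destruct (near x t) as [N1 _]; [lra|lra|].
      destruct (near (x + k * w) t) as [N2 _]; [lra|lra|].
      apply Rabs_le_between in N1; apply Rabs_le_between in N2.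
      apply Rabs_le_between; unfold minus, plus, opp; simpl; lra. }
  rewrite (@RInt_minus R_CompleteNormedModule (fun t => v t y)) in Bv by (apply Iv; lra).
  rewrite (@RInt_minus R_CompleteNormedModule (u (x + k * w))) in Bu by (apply Iu; lra).
  unfold minus, plus, opp in Bu, Bv; simpl in Bu, Bv.
  assert (sum : (k * w + k * h) * (2 * (e * (k * m))) <= eps * k ^ 2).
  { assert (T : e * (4 * m ^ 2) = eps) by (unfold e; field; lra).
    rewrite <- T.
    apply Rle_trans with (k * m * (2 * (e * (k * m)))).
    - apply Rmult_le_compat_r; [|lra].
      apply Rmult_le_pos; [lra|]; apply Rmult_le_pos; [lra|].
      apply Rmult_le_pos; lra.
    - assert (0 <= e * k ^ 2 * m ^ 2).
      { apply Rmult_le_pos; [apply Rmult_le_pos; [lra|]|]; apply pow_le; lra. }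
      lra. }
  apply Rle_trans with (2 := sum).
  apply Rabs_le_between in Bv; apply Rabs_le_between in Bu.
  apply Rabs_le_between; unfold F; lra.
Qed.

(** * Complex derivatives and the Cauchy-Riemann equations *)

Lemma is_derive_C_lim (h : C -> C) (z l : C) :
  @is_derive C_AbsRing C_NormedModule h z l ->
  forall eps, 0 < eps -> exists delta, 0 < delta /\
    forall w, Cmod (w - z) < delta ->
      Cmod (h w - h z - (w - z) * l)%C <= eps * Cmod (w - z).
Proof.
intros [_ D] eps E.
destruct (D z (fun P H => H) (mkposreal _ E)) as [delta H].
exists delta; split; [apply delta|].
intros w Hw; specialize (H w Hw).
exact H.
Qed.

(** The module structure is the one that [is_derive_comp] expects of the inner function. *)
Lemma lim_is_derive_C (h : C -> C) (z l : C) :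
  (forall eps, 0 < eps -> exists delta, 0 < delta /\
    forall w, Cmod (w - z) < delta ->
      Cmod (h w - h z - (w - z) * l)%C <= eps * Cmod (w - z)) ->
  @is_derive C_AbsRing (AbsRing_NormedModule C_AbsRing) h z l.
Proof.
intros H; split; [apply is_linear_scal_l|].
intros x Hx eps.
rewrite <- (is_filter_lim_locally_unique _ _ Hx).
destruct (H eps (cond_pos eps)) as [delta [D H']].
exists (mkposreal _ D); exact H'.
Qed.

Lemma ex_derive_C_continuous (h : C -> C) (z : C) :
  @ex_derive C_AbsRing C_NormedModule h z ->
  forall eps, 0 < eps -> exists delta, 0 < delta /\
    forall w, Cmod (w - z) < delta -> Cmod (h w - h z) < eps.
Proof.
intros [l D] eps E.
destruct (is_derive_C_lim _ _ _ D 1 Rlt_0_1) as [d [d0 H]].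
assert (L := Cmod_ge_0 l).
exists (Rmin d (eps / (1 + Cmod l))); split.
{ apply Rmin_pos; [exact d0|apply Rdiv_lt_0_compat; lra]. }
intros w Hw.
assert (Hd := Rlt_le_trans _ _ _ Hw (Rmin_l _ _)).
assert (He := Rlt_le_trans _ _ _ Hw (Rmin_r _ _)).
specialize (H w Hd).
apply Rmult_lt_compat_r with (r := 1 + Cmod l) in He; [|lra].
unfold Rdiv in He; rewrite Rmult_assoc, Rinv_l, Rmult_1_r in He by lra.
replace (h w - h z)%C with ((h w - h z - (w - z) * l) + (w - z) * l)%C by ring.
eapply Rle_lt_trans; [apply Cmod_triangle|].
rewrite Cmod_mult; lra.
Qed.

Lemma is_derive_C_re_im (h : C -> C) (x y : R) (l : C) :
  @is_derive C_AbsRing C_NormedModule h (x, y) l ->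
  differentiable_pt_lim (fun s t => Re (h (s, t))) x y (Re l) (- Im l) /\
  differentiable_pt_lim (fun s t => Im (h (s, t))) x y (Im l) (Re l).
Proof.
intros D.
enough (H : forall eps : posreal, locally_2d (fun s t =>
  Cmod (h (s, t) - h (x, y) - ((s, t) - (x, y)) * l)%C
  <= eps * Rmax (Rabs (s - x)) (Rabs (t - y))) x y).
{ split; intros eps; destruct (H eps) as [d Hd]; exists d; intros s t S T;
    (eapply Rle_trans; [|exact (Hd s t S T)]).
  - eapply Rle_trans; [|apply re_le_Cmod]; right; f_equal.
    unfold Re, Im; simpl; ring.
  - eapply Rle_trans; [|apply Rmax_Cmod].
    eapply Rle_trans; [|apply Rmax_r]; right; f_equal.
    unfold Re, Im; simpl; ring. }
intros eps.
assert (S2 := Rlt_sqrt2_0).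
(* The factor [sqrt 2] compares the modulus with the max norm of [differentiable_pt_lim]. *)
assert (E : 0 < eps / sqrt 2) by (apply Rdiv_lt_0_compat; [apply eps|exact S2]).
destruct (is_derive_C_lim _ _ _ D _ E) as [d [d0 H]].
assert (d' : 0 < d / sqrt 2) by (apply Rdiv_lt_0_compat; assumption).
exists (mkposreal _ d'); simpl; intros s t S T.
assert (N := Cmod_2Rmax ((s, t) - (x, y))%C).
change (fst ((s, t) - (x, y))%C) with (s - x) in N.
change (snd ((s, t) - (x, y))%C) with (t - y) in N.
assert (M : Rmax (Rabs (s - x)) (Rabs (t - y)) < d / sqrt 2)
  by (apply Rmax_lub_lt; assumption).
eapply Rle_trans; [apply H|].
- eapply Rle_lt_trans; [exact N|].
  replace d with (sqrt 2 * (d / sqrt 2)) by (field; lra).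
  apply Rmult_lt_compat_l; assumption.
- replace (eps * _) with
    (eps / sqrt 2 * (sqrt 2 * Rmax (Rabs (s - x)) (Rabs (t - y)))) by (field; lra).
  apply Rmult_le_compat_l; [lra|exact N].
Qed.

(** * Logarithmic polar coordinates and the mean value property *)

Lemma differentiable_pt_lim_Rmult (x y : R) :
  differentiable_pt_lim Rmult x y y x.
Proof.
intros eps; exists eps; intros s t S T.
replace (_ - _) with ((s - x) * (t - y)) by ring.
rewrite Rabs_mult; apply Rmult_le_compat; try apply Rabs_pos; [lra|apply Rmax_r].
Qed.

Lemma differentiable_pt_lim_mult (f g : R -> R) (x y f' g' : R) :
  is_derive f x f' -> is_derive g y g' ->
  differentiable_pt_lim (fun s t => f s * g t) x y (f' * g y) (f x * g').
Proof.
intros Df Dg.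
assert (F := differentiable_pt_lim_proj1_0 f x y f' (proj1 (is_derive_Reals _ _ _) Df)).
assert (G : differentiable_pt_lim (fun _ t => g t) x y 0 g').
{ intros eps.
  destruct (differentiable_pt_lim_proj1_0 g y x g' (proj1 (is_derive_Reals _ _ _) Dg) eps)
    as [d H].
  exists d; intros s t S T; rewrite Rmax_comm, (Rplus_comm (0 * _)); auto. }
generalize (differentiable_pt_lim_comp _ _ _ _ _ _ _ _ _ _ _
  (differentiable_pt_lim_Rmult (f x) (g y)) F G).
rewrite !Rmult_0_r, Rplus_0_r, Rplus_0_l, (Rmult_comm (g y)); exact (fun H => H).
Qed.

Lemma Cmod_polar (r t : R) : 0 <= r -> Cmod (r * cos t, r * sin t) = r.
Proof.
intros P; unfold Cmod; simpl fst; simpl snd.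
replace ((r * cos t) ^ 2 + (r * sin t) ^ 2) with (r ^ 2).
- apply sqrt_pow2, P.
- generalize (sin2_cos2 t); unfold Rsqr; intros E.
  transitivity (r ^ 2 * (sin t * sin t + cos t * cos t)); [rewrite E|]; ring.
Qed.

(* In the coordinates [w = exp (s + i t)] the two horizontal sides of
   [[s,0] x [0,2 PI]] cancel, so the circular means do not depend on [s]. *)
Lemma mean_value (h : C -> C) :
  (forall w, Cmod w <= 1 -> @ex_derive C_AbsRing C_NormedModule h w) ->
  is_RInt (fun t => Re (h (cos t, sin t))) 0 (2 * PI) (2 * PI * Re (h 0)).
Proof.
intros H.
set (u := fun s t => Re (h (exp s * cos t, exp s * sin t))).
set (v := fun s t => Im (h (exp s * cos t, exp s * sin t))).
assert (D : forall s t, s <= 0 -> exists us ut vs,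
  differentiable_pt_lim u s t us ut /\ differentiable_pt_lim v s t vs us).
{ intros s t S.
  destruct (H (exp s * cos t, exp s * sin t)) as [l L].
  { rewrite Cmod_polar by (left; apply exp_pos).
    rewrite <- exp_0; destruct S as [S| ->]; [left; apply exp_increasing, S|right; reflexivity]. }
  destruct (is_derive_C_re_im _ _ _ _ L) as [U V].
  assert (X := differentiable_pt_lim_mult exp cos s t _ _ (is_derive_exp s) (is_derive_cos t)).
  assert (Y := differentiable_pt_lim_mult exp sin s t _ _ (is_derive_exp s) (is_derive_sin t)).
  assert (U' := differentiable_pt_lim_comp _ _ _ _ _ _ _ _ _ _ _ U X Y).
  assert (V' := differentiable_pt_lim_comp _ _ _ _ _ _ _ _ _ _ _ V X Y).
  eexists _, _, _; split; [exact U'|].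
  (* As exp (s + i t) is holomorphic, the Cauchy-Riemann equation between the s-derivative of u and
     the t-derivative of v persists in the new coordinates. *)
  replace (Re l * _ + _) with
    (Im l * (exp s * - sin t) + Re l * (exp s * cos t)) by ring.
  exact V'. }
assert (P := PI_RGT_0).
assert (I : forall s, s <= 0 -> ex_RInt (u s) 0 (2 * PI)).
{ intros s S; apply @ex_RInt_continuous; intros t _.
  destruct (D s t S) as (us & ut & vs & U & _).
  exact (proj2 (differentiable_pt_lim_continuous _ _ _ _ _ U)). }
assert (M : forall s, s <= 0 -> RInt (u 0) 0 (2 * PI) = RInt (u s) 0 (2 * PI)).
{ intros s S.
  apply Rminus_diag_uniq.
  rewrite (closed_form_rectangle u v s 0 0 (2 * PI)).
  - unfold v; rewrite cos_2PI, sin_2PI, cos_0, sin_0; ring.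
  - exact S.
  - lra.
  - intros x y X _; apply D; lra. }
(* The circle is shrunk to a small radius r = exp (ln r), where h is close to h 0 by continuity. The
   bound r <= 1/2 ensures ln r <= 0. *)
assert (E : RInt (u 0) 0 (2 * PI) = 2 * PI * Re (h 0)).
{ apply cond_eq; intros eps E.
  destruct (ex_derive_C_continuous h 0) with (eps := eps / (4 * PI)) as [d [d0 Hd]].
  { apply H; rewrite Cmod_0; lra. }
  { apply Rdiv_lt_0_compat; lra. }
  set (r := Rmin (1 / 2) (d / 2)).
  assert (r0 : 0 < r) by (apply Rmin_pos; lra).
  assert (r1 : r <= 1 / 2) by apply Rmin_l.
  assert (r2 : r <= d / 2) by apply Rmin_r.
  assert (S : ln r <= 0) by (rewrite <- ln_1; apply ln_le; lra).
  rewrite (M (ln r) S).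
  replace (2 * PI * Re (h 0)) with ((2 * PI - 0) * Re (h 0)) by ring.
  apply Rle_lt_trans with ((2 * PI - 0) * (eps / (4 * PI))).
  - apply RInt_dist_const; [lra|apply I, S|].
    intros t _; unfold u; rewrite exp_ln by exact r0.
    eapply Rle_trans; [apply (re_le_Cmod (h ((r * cos t)%R, (r * sin t)%R) - h 0)%C)|].
    left; apply Hd.
    assert (Z : forall z : C, (z - 0 = z)%C) by (intros z; ring).
    rewrite Z, Cmod_polar; lra.
  - replace ((2 * PI - 0) * (eps / (4 * PI))) with (eps / 2) by (field; lra); lra. }
rewrite <- E.
apply is_RInt_ext with (u 0).
{ intros t _; unfold u; rewrite exp_0, !Rmult_1_l; reflexivity. }
apply (@RInt_correct R_CompleteNormedModule), I; lra.
Qed.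

(** * The auxiliary disk map and the Harnack type bound *)

Lemma one_minus_scal_ge (A : R) (w : C) :
  0 <= A -> Cmod w <= 1 -> 1 - A <= Cmod (1 - A * w)%C.
Proof.
intros A0 W.
assert (T := Cmod_triangle (1 - A * w) (A * w)).
replace (1 - A * w + A * w)%C with (RtoC 1) in T by ring.
rewrite Cmod_1, Cmod_mult, Cmod_R, (Rabs_pos_eq A A0) in T.
assert (A * Cmod w <= A * 1) by (apply Rmult_le_compat_l; assumption).
lra.
Qed.

Lemma Cmod_pos_neq_0 (z : C) : 0 < Cmod z -> z <> 0.
Proof. intros P; apply Cmod_gt_0, P. Qed.

Lemma ex_derive_mobius (a : C) (A : R) (w : C) :
  0 <= A < 1 -> Cmod w <= 1 ->
  @ex_derive C_AbsRing (AbsRing_NormedModule C_AbsRing)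
    (fun w => a * (1 - w) / (1 - A * w))%C w.
Proof.
intros [A0 A1] W.
assert (Dw := one_minus_scal_ge A w A0 W).
assert (Dw0 : (1 - A * w)%C <> 0) by (apply Cmod_pos_neq_0; lra).
exists (- a * (1 - A) / ((1 - A * w) * (1 - A * w)))%C.
apply lim_is_derive_C; intros eps E.
(* The first-order remainder is exactly B (w' - w)^2 / (1 - A w'). Staying within (1 - A)/2 of w
   keeps |1 - A w'| >= (1 - A)/2, and [d2] then makes the remainder at most eps |w' - w|; its
   summand 1 covers B = 0. *)
set (B := (- a * (1 - A) * A / ((1 - A * w) * (1 - A * w)))%C).
assert (B0 := Cmod_ge_0 B).
set (d2 := eps * (1 - A) / (2 * Cmod B + 1)).
exists (Rmin ((1 - A) / 2) d2); split.
{ apply Rmin_pos; [lra|].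
  apply Rdiv_lt_0_compat; [apply Rmult_lt_0_compat|]; lra. }
intros w' H.
assert (H1 := Rlt_le_trans _ _ _ H (Rmin_l _ _)).
assert (H2 := Rlt_le_trans _ _ _ H (Rmin_r _ _)).
assert (Dw' : (1 - A) / 2 <= Cmod (1 - A * w')%C).
{ assert (T := Cmod_triangle (1 - A * w') (A * (w' - w))).
  replace (1 - A * w' + A * (w' - w))%C with (1 - A * w)%C in T by ring.
  rewrite (Cmod_mult A), Cmod_R, (Rabs_pos_eq A A0) in T.
  assert (A * Cmod (w' - w) <= 1 * Cmod (w' - w))
    by (apply Rmult_le_compat_r; [apply Cmod_ge_0|lra]).
  lra. }
assert (Dw'0 : (1 - A * w')%C <> 0) by (apply Cmod_pos_neq_0; lra).
replace (_ - _ - _)%C with (B / (1 - A * w') * (w' - w) * (w' - w))%C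
  by (unfold B; field; split; assumption).
rewrite !Cmod_mult, Cmod_div by exact Dw'0; unfold Rdiv at 1.
apply Rmult_le_compat_r; [apply Cmod_ge_0|].
assert (I : / Cmod (1 - A * w') <= 2 / (1 - A)).
{ replace (2 / (1 - A)) with (/ ((1 - A) / 2)) by (field; lra).
  apply Rinv_le_contravar; lra. }
apply Rle_trans with (Cmod B * (2 / (1 - A)) * d2).
- apply Rmult_le_compat; try apply Cmod_ge_0; [|apply Rmult_le_compat_l; assumption|lra].
  apply Rmult_le_pos; [exact B0|left; apply Rinv_0_lt_compat; lra].
- unfold d2.
  replace (_ * _ * _) with (eps * (2 * Cmod B / (2 * Cmod B + 1))) by (field; lra).
  rewrite <- (Rmult_1_r eps) at 2.
  apply Rmult_le_compat_l; [lra|].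
  apply Rle_div_l; lra.
Qed.

(** With A = |a|^2, this follows from |1 - A w|^2 - A |1 - w|^2 = (1 - A)(1 - A |w|^2) > 0. *)
Lemma Cmod_mobius_lt_1 (a w : C) :
  Cmod a < 1 -> Cmod w <= 1 ->
  Cmod (a * (1 - w) / (1 - RtoC (Cmod a ^ 2) * w)) < 1.
Proof.
intros a1 W.
assert (a0 := Cmod_ge_0 a).
assert (A0 : 0 <= Cmod a ^ 2) by (apply pow_le; exact a0).
set (A := Cmod a ^ 2) in *.
assert (A1 : A < 1) by (unfold A; nra).
assert (D := one_minus_scal_ge A w A0 W).
rewrite Cmod_div, Cmod_mult by (apply Cmod_pos_neq_0; lra).
apply Rlt_div_l; [lra|]; rewrite Rmult_1_l.
apply Rsqr_incrst_0; [|apply Rmult_le_pos; apply Cmod_ge_0|apply Cmod_ge_0].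
rewrite !Rsqr_pow2, Rpow_mult_distr; fold A.
assert (W2 : Cmod w ^ 2 <= 1) by (assert (w0 := Cmod_ge_0 w); nra).
rewrite Cmod2_alt in W2; rewrite !Cmod2_alt.
destruct w as [x y]; unfold Re, Im in *; simpl in *.
assert (0 < (1 - A) * (1 - A * (x * x + y * y))).
{ apply Rmult_lt_0_compat; [lra|]; assert (A * (x * x + y * y) <= A * 1); [|lra].
  apply Rmult_le_compat_l; lra. }
lra.
Qed.

(** The chord |1 - e^{it}| equals 2 sin (t/2), and sin x <= x for x >= 0. *)
Lemma Cmod_one_minus_cis_le (t : R) :
  0 <= t <= 1 -> Cmod (1 - (cos t, sin t))%C <= t.
Proof.
intros [T0 T1].
apply Rsqr_incr_0; [|apply Cmod_ge_0|exact T0].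
rewrite !Rsqr_pow2, Cmod2_alt; unfold Re, Im; simpl.
assert (C2 := cos_2a_sin (t / 2)).
replace (2 * (t / 2)) with t in C2 by field.
assert (S0 : 0 <= sin (t / 2)).
{ apply sin_ge_0; [lra|]; assert (P := PI2_1); lra. }
assert (S1 : sin (t / 2) <= t / 2).
{ destruct T0 as [T0| <-]; [left; apply sin_lt_x; lra|].
  replace (0 / 2) with 0 by field; rewrite sin_0; lra. }
assert (E := sin2_cos2 t); unfold Rsqr in E.
nra.
Qed.

(* Mean value property for [p] precomposed with
   [w |-> a (1 - w) / (1 - |a|^2 w)], which sends [0] to [a] and [1] to [0]:
   near [w = 1] the integrand is at least [Re (p 0) / 2]. *)
Lemma Re_bounded_below (p : C -> C) (rho : R) :
  holomorphic_on_disk p ->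
  (forall z, unit_disk z -> 0 <= Re (p z)) ->
  0 < Re (p 0) -> rho < 1 ->
  exists c, 0 < c /\ forall a, Cmod a <= rho -> c <= Re (p a).
Proof.
intros Hol Pos P0 R1.
destruct (Rlt_le_dec rho 0) as [Rneg|R0].
{ exists 1; split; [lra|]; intros a Ha; assert (T := Cmod_ge_0 a); lra. }
assert (D0 : unit_disk 0) by (unfold unit_disk; rewrite Cmod_0; lra).
destruct (ex_derive_C_continuous p 0 (Hol 0 D0) (Re (p 0) / 2)) as [d [d0 Hd]]; [lra|].
assert (R2 : 0 < 1 - rho ^ 2) by nra.
(* For 0 <= t <= tau the disk map [psi] below satisfies |psi (e^{it})| <= t / (1 - rho^2) <= d/2,
   uniformly in |a| <= rho. *)
set (tau := Rmin 1 (d * (1 - rho ^ 2) / 2)).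
assert (dR : 0 < d * (1 - rho ^ 2)) by (apply Rmult_lt_0_compat; assumption).
assert (t0 : 0 < tau) by (apply Rmin_pos; lra).
assert (t1 : tau <= 1) by apply Rmin_l.
assert (t2 : tau <= d * (1 - rho ^ 2) / 2) by apply Rmin_r.
assert (P := PI2_1).
(* The arc [0, tau] contributes at least tau Re (p 0) / 2 to the integral 2 PI Re (p a); the rest of
   the circle contributes a nonnegative amount. *)
exists (tau * (Re (p 0) / 2) / (2 * PI)); split.
{ apply Rdiv_lt_0_compat; [apply Rmult_lt_0_compat|]; lra. }
intros a Ha.
assert (a0 := Cmod_ge_0 a).
assert (A01 : 0 <= Cmod a ^ 2 <= rho ^ 2) by (split; [apply pow_le|apply pow_incr]; lra).
set (psi := fun w : C => (a * (1 - w) / (1 - RtoC (Cmod a ^ 2) * w))%C).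
assert (Dpsi : forall w, Cmod w <= 1 -> unit_disk (psi w)).
{ intros w W; apply Cmod_mobius_lt_1; [lra|exact W]. }
assert (M := mean_value (fun w => p (psi w))).
assert (psi0 : psi 0 = a).
{ unfold psi; field. }
cbv beta in M; rewrite psi0 in M.
assert (cis1 : forall t, Cmod (cos t, sin t) = 1).
{ intros t; rewrite <- (Cmod_polar 1 t), !Rmult_1_l by lra; reflexivity. }
set (g := fun t => Re (p (psi (cos t, sin t)))).
assert (I : is_RInt g 0 (2 * PI) (2 * PI * Re (p a))).
{ apply M; intros w W.
  destruct (Hol (psi w) (Dpsi w W)) as [l1 L1].
  destruct (ex_derive_mobius a (Cmod a ^ 2) w) as [l2 L2]; [lra|exact W|].
  eexists; apply (is_derive_comp p psi w _ _ L1 L2). }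
assert (Iex : ex_RInt g 0 (2 * PI)) by (eexists; exact I).
assert (I1 : ex_RInt g 0 tau)
  by (apply (@ex_RInt_Chasles_1 R_CompleteNormedModule) with (2 * PI); [lra|exact Iex]).
assert (I2 : ex_RInt g tau (2 * PI))
  by (apply (@ex_RInt_Chasles_2 R_CompleteNormedModule) with 0; [lra|exact Iex]).
assert (Ch : RInt g 0 tau + RInt g tau (2 * PI) = 2 * PI * Re (p a)).
{ rewrite <- (is_RInt_unique _ _ _ _ I).
  apply (@RInt_Chasles R_CompleteNormedModule); assumption. }
assert (J2 : 0 <= RInt g tau (2 * PI)).
{ apply RInt_ge_0; [lra|exact I2|].
  intros t _; apply Pos, Dpsi; rewrite cis1; lra. }
assert (J1 : tau * (Re (p 0) / 2) <= RInt g 0 tau).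
{ replace (tau * (Re (p 0) / 2)) with (RInt (fun _ => Re (p 0) / 2) 0 tau).
  2:{ rewrite RInt_const; unfold scal; simpl; unfold mult; simpl; ring. }
  apply RInt_le; [lra|apply ex_RInt_const|exact I1|].
  intros t T; unfold g.
  assert (B : Cmod (psi (cos t, sin t) - 0)%C < d).
  { replace (psi (cos t, sin t) - 0)%C with (psi (cos t, sin t)) by ring.
    unfold psi.
    assert (Dn := one_minus_scal_ge (Cmod a ^ 2) (cos t, sin t) (proj1 A01)).
    rewrite cis1 in Dn; specialize (Dn (Rle_refl 1)).
    rewrite Cmod_div, Cmod_mult by (apply Cmod_pos_neq_0; lra).
    apply Rlt_div_l; [lra|].
    apply Rle_lt_trans with (1 * tau).
    - apply Rmult_le_compat; try apply Cmod_ge_0; [lra|].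
      eapply Rle_trans; [apply Cmod_one_minus_cis_le; lra|lra].
    - apply Rlt_le_trans with (d * (1 - rho ^ 2)); [lra|].
      apply Rmult_le_compat_l; lra. }
  specialize (Hd _ B).
  assert (Q := Rle_lt_trans _ _ _ (re_le_Cmod _) Hd).
  apply Rabs_lt_between in Q.
  unfold Re, Cminus, Cplus, Copp in Q; simpl in Q; unfold Re; lra. }
apply Rle_div_l; lra.
Qed.

(** * Compact subsets of the disk and convergence of the resolvents *)

(** The open disks of radius less than 1 about 0 cover K; a finite subcover has a largest radius. *)
Lemma compact_in_disk (K : C -> Prop) :
  compact_C K -> (forall z, K z -> unit_disk z) ->
  exists rho, rho < 1 /\ forall z, K z -> Cmod z <= rho.
Proof.
intros cK dK.
destruct (cK {rho | rho < 1} (fun i z => Cmod z < proj1_sig i)) as [l Hl].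
{ intros [rho R1]; simpl.
  apply (open_comp Cmod (fun u => u < rho)).
  - intros z _; apply (@filterlim_norm C_AbsRing C_NormedModule).
  - apply open_lt. }
{ intros z Hz; specialize (dK z Hz); unfold unit_disk in dK.
  unshelve eexists (exist _ ((Cmod z + 1) / 2) _); simpl; lra. }
assert (L : exists rho, rho < 1 /\ forall i, In i l -> proj1_sig i <= rho).
{ clear Hl; induction l as [|i l [rho [R1 IH]]].
  - exists 0; split; [lra|]; intros i [].
  - exists (Rmax (proj1_sig i) rho); split.
    + apply Rmax_lub_lt; [apply (proj2_sig i)|exact R1].
    + intros j [<-|Hj]; [apply Rmax_l|].
      eapply Rle_trans; [apply IH, Hj|apply Rmax_r]. }
destruct L as [rho [R1 L]].
exists rho; split; [exact R1|]; intros z Hz.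
destruct (Hl z Hz) as [i [Hi Hi']]; specialize (L i Hi); lra.
Qed.

Open Scope C_scope.

Theorem corollary3p4 :
  forall (q : C) (f : C -> C) (G : R -> C -> C),
    (0 < Re q)%R ->
    generator_at_0 q f ->
    (forall r : R, (0 < r)%R -> is_resolvent f r (G r)) ->
    forall K : C -> Prop,
      compact_C K ->
      (forall z : C, K z -> unit_disk z) ->
      cvg_uniformly_on K (fun (r : R) (z : C) => (1 + RtoC r * q) * G r z) (fun z : C => z).
Proof.
intros q f G q0 (p & Hol & Pos & <- & Hf) HG K cK dK eps.
destruct (compact_in_disk K cK dK) as [rho [R1 HK]].
destruct (Re_bounded_below p rho Hol Pos q0 R1) as [c [c0 Hc]].
(* The factor c offsets the bound r |z| < 1/c in the final estimate of r |z| |p z - p 0|. *)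
destruct (ex_derive_C_continuous p 0) with (eps := (eps * c)%R) as [d [d0 Hd]].
{ apply Hol; unfold unit_disk; rewrite Cmod_0; lra. }
{ apply Rmult_lt_0_compat; [apply eps|exact c0]. }
(* Beyond this threshold 1/(c r) < d, so the bound |z| < 1/(c r) puts z where p is close to p 0. *)
exists (/ (c * d))%R; intros r Hr w Kw.
assert (cd : (0 < c * d)%R) by (apply Rmult_lt_0_compat; assumption).
assert (r0 : (0 < r)%R) by (assert (T := Rinv_0_lt_compat _ cd); lra).
assert (crd : (1 < c * r * d)%R).
{ apply Rmult_lt_compat_l with (r := (c * d)%R) in Hr; [|exact cd].
  rewrite Rinv_r in Hr; lra. }
destruct (HG r r0) as (_ & GD & GE).
specialize (GD w (dK w Kw)); specialize (GE w (dK w Kw)).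
rewrite (Hf _ GD) in GE.
set (z := G r w) in *.
assert (E : z * (1 + r * p z) = w) by (rewrite <- GE; ring).
assert (z0 := Cmod_ge_0 z).
assert (rP : (0 <= r * Re (p z))%R) by (apply Rmult_le_pos; [lra|apply Pos, GD]).
assert (Re1 : (1 + r * Re (p z) <= Cmod (1 + r * p z))%R).
{ eapply Rle_trans; [|apply re_le_Cmod]; eapply Rle_trans; [|apply Rle_abs].
  right; unfold Re; simpl; ring. }
assert (Ew : (Cmod z * Cmod (1 + r * p z) = Cmod w)%R) by (rewrite <- Cmod_mult, E; reflexivity).
assert (w_rho := HK w Kw).
(* This crude bound puts z in the disk of radius rho, where the lower bound c on Re p is
   available. *)
assert (zw : (Cmod z <= Cmod w)%R) by (rewrite <- Ew; nra).
assert (cz := Hc z (Rle_trans _ _ _ zw w_rho)).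
assert (crz : (c * r * Cmod z < 1)%R).
{ assert (r * c <= r * Re (p z))%R by (apply Rmult_le_compat_l; lra).
  assert (Cmod z * (r * c) <= Cmod z * Cmod (1 + r * p z))%R
    by (apply Rmult_le_compat_l; lra).
  lra. }
assert (cr : (0 < c * r)%R) by (apply Rmult_lt_0_compat; assumption).
assert (zd : (Cmod (z - 0) < d)%R).
{ replace (z - 0) with z by ring.
  apply Rmult_lt_reg_l with (c * r)%R; lra. }
specialize (Hd z zd).
replace ((1 + r * p 0) * z - w) with (- (r * z * (p z - p 0)))
  by (rewrite <- E; ring).
rewrite Cmod_opp, !Cmod_mult, Cmod_R, Rabs_pos_eq by lra.
apply Rmult_lt_reg_l with c; [exact c0|].
assert (e0 := cond_pos eps).
assert (c * r * Cmod z * Cmod (p z - p 0) <= 1 * Cmod (p z - p 0))%R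
  by (apply Rmult_le_compat_r; [apply Cmod_ge_0|lra]).
lra.
Qed.
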